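(* Let $\theta$ be a $B$-action and let $(X,d_\theta)$ be a $\theta$-metric space. Then $(X,\tau_{d_\theta})$ is a metrizable topological space.
   Context: A $B$-action is a map $\theta:[0,+\infty)\times[0,+\infty)\to[0,+\infty)$, continuous with respect to each variable, such that, with $\mathrm{Im}(\theta)=\{\theta(s,t):s,t\ge 0\}$: (I) $\theta(0,0)=0$ and $\theta(t,s)=\theta(s,t)$ for all $t,s\ge 0$; (II) $\theta(s,t)<\theta(u,v)$ whenever either $s<u$ and $t\le v$, or $s\le u$ and $t<v$; (III) for each $r\in \mathrm{Im}(\theta)\setminus\{0\}$ and each $s\in(0,r]$ there exists $t\in[0,r]$ with $\theta(t,s)=r$; (IV) $\theta(s,0)\le s$ for all $s>0$. A $\theta$-metric on a nonempty set $X$ is a map $d_\theta:X\times X\to[0,+\infty)$ such that for all $x,y,z\in X$: $d_\theta(x,y)=0$ iff $x=y$; $d_\theta(x,y)=d_\theta(y,x)$; $d_\theta(x,y)\le\theta(d_\theta(x,z),d_\theta(z,y))$. Then $(X,d_\theta)$ is called a $\theta$-metric space. For $x\in X$ and $r\in \mathrm{Im}(\theta)$ put $B_{d_\theta}(x,r)=\{y\in X: d_\theta(x,y)<r\}$. The induced topology $\tau_{d_\theta}$ on $X$ consists of all $A\subset X$ such that for every $x\in A$ there is $r\in \mathrm{Im}(\theta)\setminus\{0\}$ with $B_{d_\theta}(x,r)\subset A$. *)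

(* Defs.v *)
From HB Require Import structures.
From mathcomp Require Import all_boot all_order all_algebra.
From mathcomp Require Import all_classical all_reals all_analysis.

Set Implicit Arguments.
Unset Strict Implicit.
Unset Printing Implicit Defensive.

Import Order.TTheory GRing.Theory Num.Theory.
Import numFieldNormedType.Exports.

Local Open Scope classical_set_scope.
Local Open Scope ring_scope.

(* A map [0,+oo[ x [0,+oo[ -> [0,+oo[ is represented by a function
   theta : R -> R -> R of which only the values at nonnegative arguments are
   ever constrained or used. *)

Definition theta_Im (R : realType) (theta : R -> R -> R) : set R :=
  [set r | exists s t : R, [/\ 0 <= s, 0 <= t & r = theta s t]].

Record B_action (R : realType) (theta : R -> R -> R) : Prop := {
  B_action_ge0 : forall s t : R, 0 <= s -> 0 <= t -> 0 <= theta s t;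
  B_action_continuousl : forall t : R, 0 <= t ->
    {within `[0, +oo[, continuous (fun s : R => theta s t)};
  B_action_continuousr : forall s : R, 0 <= s ->
    {within `[0, +oo[, continuous (fun t : R => theta s t)};
  B_action00 : theta 0 0 = 0;
  B_actionC : forall s t : R, 0 <= s -> 0 <= t -> theta t s = theta s t;
  B_action_mono : forall s t u v : R,
    0 <= s -> 0 <= t -> 0 <= u -> 0 <= v ->
    (s < u /\ t <= v) \/ (s <= u /\ t < v) -> theta s t < theta u v;
  B_action_solve : forall r s : R,
    theta_Im theta r -> r <> 0 -> 0 < s -> s <= r ->
    exists t : R, [/\ 0 <= t, t <= r & theta t s = r];
  B_action0_le : forall s : R, 0 < s -> theta s 0 <= s
}.

Record theta_metric (R : realType) (theta : R -> R -> R) (X : Type)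
    (d : X -> X -> R) : Prop := {
  theta_metric_ge0 : forall x y : X, 0 <= d x y;
  theta_metric_eq0 : forall x y : X, d x y = 0 <-> x = y;
  theta_metric_sym : forall x y : X, d x y = d y x;
  theta_metric_triangle : forall x y z : X, d x y <= theta (d x z) (d z y)
}.

Definition theta_ball (R : realType) (X : Type) (d : X -> X -> R)
    (x : X) (r : R) : set X := [set y | d x y < r].

Definition theta_topology (R : realType) (theta : R -> R -> R) (X : Type)
    (d : X -> X -> R) : set (set X) :=
  [set A | forall x, A x ->
     exists r : R, [/\ theta_Im theta r, r <> 0 & theta_ball d x r `<=` A]].

(* The third clause includes the empty family, hence the empty set. *)
Record is_topology (X : Type) (tau : set (set X)) : Prop := {
  is_topologyT : tau setT;
  is_topologyI : setI_closed tau;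
  is_topology_bigcup : forall (I : Type) (f : I -> set X),
    (forall i, tau (f i)) -> tau (\bigcup_i f i)
}.

(* [Metric R X] is the class of metricType structures on the carrier X itself,
   so this says that some R-valued metric on X has tau as its open sets. *)
Definition metrizable (R : realType) (X : Type) (tau : set (set X)) : Prop :=
  exists m : Metric R X,
    forall A : set X, tau A <-> @open (Metric.Pack m) A.

(* Main.v *)
Require Import Defs.
From HB Require Import structures.
From mathcomp Require Import all_boot all_order all_algebra.
From mathcomp Require Import all_classical all_reals all_analysis.

(* Continuity of theta(e/2, .) at 0 together with theta(e/2, 0) <= e/2 < e gives
   r > 0 with theta(r, r) < e. Hence the sets {d < e} form a countably generated
   Hausdorff uniformity, which is pseudometrizable by the classical chain
   construction; the infimum of the radii of the balls joining two points is
   then a metric. *)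

Set Implicit Arguments.
Unset Strict Implicit.
Unset Printing Implicit Defensive.

Import Order.TTheory GRing.Theory Num.Theory.
Import numFieldNormedType.Exports.

Local Open Scope classical_set_scope.
Local Open Scope ring_scope.

Lemma open_is_topology (T : topologicalType) : is_topology (@open T).
Proof.
split; [exact: openT|exact: openI|].
by move=> I f of_; apply: bigcup_open => i _; exact: of_.
Qed.

Section DistType.
Variables (R : realType) (T : choiceType) (dist : T -> T -> R).
Hypotheses (dist_xx : forall x, dist x x = 0)
  (dist_eq0 : forall x y, dist x y = 0 -> x = y)
  (dist_sym : forall x y, dist x y = dist y x)
  (dist_triangle : forall y x z, dist x z <= dist x y + dist y z).

(* The [let] makes the type depend on the axioms, so that its metric structure
   can be inferred after the section is closed. *)
Definition dist_type : Type :=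
  let _ := (dist_xx, dist_eq0, dist_sym, dist_triangle) in T.

HB.instance Definition _ := Choice.on dist_type.
HB.instance Definition _ :=
  isMetric.Build R dist_type dist_xx dist_eq0 dist_sym dist_triangle.

End DistType.

Section PseudoMetricMetrizable.
Variables (R : realType) (T : pseudoMetricType R).
Hypothesis ball_total : forall x y : T, exists2 r : R, 0 < r & ball x r y.

(** [edist] takes values in the extended reals; [ball_total] makes it finite, so [fine] keeps its
    value. *)
Let rdist (x y : T) : R := fine (edist (x, y)).

Let edistE x y : edist (x, y) = (rdist x y)%:E.
Proof. by rewrite fineK//; apply/edist_finP; exact: ball_total. Qed.

Let rdist_lt_ball x y r : rdist x y < r -> ball x r y.
Proof.
by move=> xyr; apply: (@edist_lt_ball R T r (x, y)); rewrite edistE lte_fin.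
Qed.

Let ball_le_rdist x y r : 0 < r -> ball x r y -> rdist x y <= r.
Proof. by move=> r0 b; rewrite -lee_fin -edistE; exact: edist_fin. Qed.

Let rdistxx x : rdist x x = 0.
Proof.
apply/eqP; rewrite eq_le; apply/andP; split.
  apply/ler_addgt0Pl => e e0; rewrite addr0.
  by apply: ball_le_rdist => //; exact: ballxx.
by rewrite -lee_fin -edistE edist_ge0.
Qed.

Let rdist_sym x y : rdist x y = rdist y x.
Proof. by rewrite /rdist edist_sym. Qed.

Let rdist_triangle y x z : rdist x z <= rdist x y + rdist y z.
Proof. by rewrite -lee_fin EFinD -!edistE; exact: edist_triangle. Qed.

Lemma pseudometric_metrizable : hausdorff_space T -> metrizable R (@open T).
Proof.
move=> hT.
have rdist_eq0 x y : rdist x y = 0 -> x = y.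
  (* At distance 0, [y] lies in every ball around [x], so any neighbourhoods of [x] and [y] meet at
     [y] itself. *)
  move=> xy0; apply: hT => A B /nbhs_ballP[e /= e0 eA] /nbhs_singleton By.
  by exists y; split=> //; apply/eA/rdist_lt_ball; rewrite xy0.
pose M : metricType R := dist_type rdistxx rdist_eq0 rdist_sym rdist_triangle.
exists (Metric.class M) => A; rewrite !openE.
have nbhsE (x : T) : nbhs x A <-> @nbhs _ M x A.
  split=> [/nbhs_ballP[e /= e0 eA]|].
    apply/(@metricType_numDomainType.nbhs_mdistP R M).
    by exists e => // y /= xy; exact/eA/rdist_lt_ball.
  (* Lying in a ball bounds the infimum of the radii only non-strictly; halving [e] restores the
     strict inequality. *)
  move=> /(@metricType_numDomainType.nbhs_mdistP R M)[e /= e0 eA].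
  apply/nbhs_ballP; exists (e / 2); first by rewrite /= divr_gt0.
  move=> y xy; apply: eA => /=.
  apply: le_lt_trans (ball_le_rdist _ xy) _; first by rewrite divr_gt0.
  by rewrite ltr_pdivrMr// ltr_pMr// ltr1n.
by split=> oA x Ax; apply/nbhsE; exact: oA.
Qed.

End PseudoMetricMetrizable.

(** [countable_uniform] equips [T] with a pseudometric inducing the same uniformity. It is bounded,
    any two points lying in a common ball of radius 2, so its infimum of radii is finite. *)
Lemma countable_uniformity_metrizable (R : realType) (T : uniformType) :
  countable_uniformity T -> hausdorff_space T -> metrizable R (@open T).
Proof.
move=> cT hT.
have ball_total (x y : countable_uniform cT) :
    exists2 r : R, 0 < r & ball x r y.
  by exists 2 => //; exact: countable_uniform.countable_uniform_bounded.
exact: (pseudometric_metrizable ball_total hT).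
Qed.

Lemma B_action_diag_small (R : realType) (theta : R -> R -> R) (e : R) :
  B_action theta -> 0 < e -> exists2 r, 0 < r & theta r r < e.
Proof.
move=> Bt e0.
have e20 : 0 < e / 2 by rewrite divr_gt0.
have te2 : theta (e / 2) 0 < e.
  apply: le_lt_trans (B_action0_le Bt e20) _.
  by rewrite ltr_pdivrMr// ltr_pMr// ltr1n.
have ct := B_action_continuousr Bt (ltW e20).
have /subspace_continuousP/(_ 0) := ct.
rewrite /= in_itv/= lexx => /(_ isT) /cvgrPdist_lt.
(* The tolerance is the gap left below [e] at the point 0. *)
move=> /(_ (e - theta (e / 2) 0)).
rewrite subr_gt0 => /(_ te2); rewrite near_withinE.
move=> /nbhs_ballP[r /= r0 rP].
(* The bound [e / 2] lets monotonicity raise the first argument to [e / 2]; the bound [r / 2] keeps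
   the second one strictly inside the continuity radius. *)
exists (Num.min (e / 2) (r / 2)); first by rewrite lt_min e20 divr_gt0.
set s := Num.min _ _.
have s0 : 0 < s by rewrite lt_min e20 divr_gt0.
have se : s <= e / 2 by rewrite ge_min lexx.
have sr : s < r.
  by rewrite gt_min [X in _ || X]ltr_pdivrMr// ltr_pMr// ltr1n orbT.
have le_tss : theta s s <= theta (e / 2) s.
  move: se; rewrite le_eqVlt => /predU1P[<-//|se].
  apply/ltW/(B_action_mono Bt); [exact: ltW..|].
  by left; split.
apply: le_lt_trans le_tss _.
have : `|theta (e / 2) 0 - theta (e / 2) s| < e - theta (e / 2) 0.
  apply: rP; last by rewrite in_itv/= ltW.
  by rewrite /ball/= sub0r normrN gtr0_norm.
by rewrite distrC => /(le_lt_trans (ler_norm _)); rewrite ltrD2r.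
Qed.

Lemma B_action_homo (R : realType) (theta : R -> R -> R) (s t r : R) :
  B_action theta -> 0 <= s -> 0 <= t -> s < r -> t < r ->
  theta s t < theta r r.
Proof.
move=> Bt s0 t0 sr tr.
have r0 := ltW (le_lt_trans s0 sr).
by apply: (B_action_mono Bt) => //; left; split => //; exact: ltW.
Qed.

Section ThetaUniformity.
Variables (R : realType) (theta : R -> R -> R) (X : Type) (d : X -> X -> R).
Hypotheses (Bt : B_action theta) (md : theta_metric theta d).

Let dxx x : d x x = 0. Proof. exact/(theta_metric_eq0 md). Qed.

(** The radii here are all positive reals, not only those in Im(theta); [theta_topologyE] reconciles
    the two. *)
Let ent : set_system (X * X) := entourage_ (theta_ball d).

Let ent_filter : Filter ent.
Proof.
apply: filter_from_filter; first by exists 1 => /=.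
move=> a b /= a0 b0; exists (Num.min a b); first by rewrite /= lt_min a0.
by move=> [x y]; rewrite /theta_ball/= lt_min => /andP[].
Qed.

Let ent_diagonal A : ent A -> diagonal `<=` A.
Proof.
move=> [e /= e0 eA] [x y]; rewrite /diagonal/= => ->.
by apply: eA; rewrite /theta_ball/= dxx.
Qed.

Let ent_inv A : ent A -> ent (A^-1)%relation.
Proof.
move=> [e /= e0 eA]; exists e => // -[x y] /= xy; apply: eA => /=.
by rewrite /theta_ball/= (theta_metric_sym md).
Qed.

(** Two steps of length below [r] compose to one of length below [theta r r], so a small diagonal
    value plays the part of halving the radius. *)
Let ent_split A : ent A -> exists2 B, ent B & (B \; B `<=` A)%relation.
Proof.
move=> [e /= e0 eA]; have [r r0 rre] := B_action_diag_small Bt e0.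
exists [set xy | theta_ball d xy.1 r xy.2]; first by exists r.
move=> [x y] [z /= xz zy]; apply: eA; rewrite /theta_ball/=.
apply: le_lt_trans (theta_metric_triangle md x y z) _.
apply: lt_trans rre; apply: B_action_homo => //; exact: theta_metric_ge0 md _ _.
Qed.

(** As in [dist_type], the [let] records the hypotheses on which the uniform structure depends. *)
Definition theta_uniform : Type := let _ := (Bt, md) in X.

HB.instance Definition _ := gen_eqMixin theta_uniform.
HB.instance Definition _ := gen_choiceMixin theta_uniform.
HB.instance Definition _ :=
  isUniform.Build theta_uniform ent_filter ent_diagonal ent_inv ent_split.

Lemma theta_uniform_nbhsP (x : theta_uniform) (A : set X) :
  nbhs x A <-> exists2 r, 0 < r & theta_ball d x r `<=` A.
Proof.
split=> [/nbhsP[E [r /= r0 rE] EA]|[r r0 rA]].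
  by exists r => // y xy; apply/EA/xsectionP; exact: rE.
apply/nbhsP; exists [set xy | theta_ball d xy.1 r xy.2]; first by exists r.
by move=> y /xsectionP; exact: rA.
Qed.

Lemma theta_uniform_countable : countable_uniformity theta_uniform.
Proof.
apply/countable_uniformityP.
exists (fun n => [set xy | theta_ball d xy.1 n.+1%:R^-1 xy.2]); last first.
  by move=> n; exists n.+1%:R^-1 => //=; rewrite invr_gt0.
(* With this [n], [n.+1] exceeds [e^-1], so the radius [n.+1%:R^-1] is below [e]. *)
move=> A [e /= e0 eA]; exists (Num.truncn e^-1).
move=> xy /= xyn; apply: eA; apply: (lt_le_trans xyn).
by rewrite -[leRHS]invrK lef_pV2 ?posrE ?invr_gt0// ltW// truncnS_gt.
Qed.

(** If [d x y] were positive, the balls of radius [r] around [x] and [y], with [theta r r < d x y],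
    would be disjoint by the triangle inequality. *)
Lemma theta_uniform_hausdorff : hausdorff_space theta_uniform.
Proof.
move=> x y xy; apply/(theta_metric_eq0 md)/eqP.
rewrite eq_le (theta_metric_ge0 md) andbT leNgt; apply/negP => dxy.
have [r r0 rre] := B_action_diag_small Bt dxy.
have nb (z : theta_uniform) : nbhs z (theta_ball d z r).
  by apply/theta_uniform_nbhsP; exists r.
have [z [xz yz]] := xy _ _ (nb x) (nb y).
have : d x y < theta r r.
  apply: le_lt_trans (theta_metric_triangle md x y z) _.
  apply: B_action_homo => //; try exact: theta_metric_ge0 md _ _.
  by rewrite (theta_metric_sym md).
by rewrite ltNge (ltW rre).
Qed.

(* The radii of theta_topology range over Im(theta) \ {0}, which contains
   theta(r, 0), with 0 < theta(r, 0) <= r, for every r > 0. *)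
Lemma theta_topologyE : theta_topology theta d = @open theta_uniform.
Proof.
apply/seteqP; split=> A; rewrite openE => oA x /oA.
  move=> [r [[s [t [s0 t0 ->]]] /eqP r0 rA]].
  apply/theta_uniform_nbhsP; exists (theta s t) => //.
  by rewrite lt_neqAle eq_sym r0 (B_action_ge0 Bt).
move=> /theta_uniform_nbhsP[r r0 rA]; exists (theta r 0); split.
- by exists r, 0; rewrite ltW.
- apply/eqP; rewrite gt_eqF// -[ltLHS](B_action00 Bt).
  by apply: (B_action_mono Bt) => //; [exact: ltW|left].
- by move=> y /= xy; apply: rA; exact: lt_le_trans xy (B_action0_le Bt r0).
Qed.

End ThetaUniformity.

Theorem theorem2p4 (R : realType) (theta : R -> R -> R) (X : Type)
    (d : X -> X -> R) :
  B_action theta ->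
  inhabited X ->
  theta_metric theta d ->
  is_topology (theta_topology theta d) /\
  metrizable R (theta_topology theta d).
Proof.
move=> Bt _ md; rewrite (theta_topologyE Bt md); split.
  exact: (@open_is_topology (theta_uniform Bt md)).
exact: (countable_uniformity_metrizable R
  (theta_uniform_countable Bt md) (@theta_uniform_hausdorff _ _ _ _ Bt md)).
Qed.
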